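(* Let $n\le m$ be positive integers. Suppose the product of simplices $\Delta^{n-1}\times\Delta^{m-1}$ is covered by $mn$ sets $A_{ij}$ $(i\in[n], j\in[m])$, which are either all open or all closed (in $\Delta^{n-1}\times\Delta^{m-1}$), such that for every $i\in[n]$, $j\in[m]$ the set $A_{ij}$ does not intersect $\partial_i\Delta^{n-1}\times\Delta^{m-1}$ and does not intersect $\Delta^{n-1}\times\partial_j\Delta^{m-1}$. Let $a_1,\ldots,a_n$ be positive integers with $\sum_{i=1}^n a_i=m$. Then there exists a map $\sigma:[m]\to[n]$ such that $|\sigma^{-1}(i)|=a_i$ for all $i\in[n]$ and $$\bigcap_{j=1}^m A_{\sigma(j)j}\neq\emptyset.$$
   Context: $[n]=\{1,2,\ldots,n\}$. $\Delta^{d}$ denotes the $d$-dimensional geometric simplex, whose points are given by barycentric coordinates $(t_1,\ldots,t_{d+1})$ with all $t_i\ge 0$ and $\sum_{i=1}^{d+1}t_i=1$. For $i\in[d+1]$, $\partial_i\Delta^d=\{(t_1,\ldots,t_{d+1})\in\Delta^d: t_i=0\}$ is the $i$-th facet. *)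

(* Defs.v *)
From mathcomp Require Import all_boot all_order all_algebra.
From mathcomp Require Import all_classical all_reals all_analysis.

Set Implicit Arguments.
Unset Strict Implicit.
Unset Printing Implicit Defensive.

Import Order.TTheory GRing.Theory Num.Theory.

Local Open Scope classical_set_scope.
Local Open Scope ring_scope.

(* [simplex R n] has n vertices, hence dimension n - 1; it is empty for n = 0. *)
Definition simplex (R : realType) (n : nat) : set 'rV[R]_n :=
  [set t : 'rV[R]_n | (forall i : 'I_n, 0 <= t ord0 i) /\
                      \sum_(i < n) t ord0 i = 1].

Arguments simplex R n : clear implicits.

Definition simplex_facet (R : realType) (n : nat) (i : 'I_n) : set 'rV[R]_n :=
  [set t : 'rV[R]_n | simplex R n t /\ t ord0 i = 0].

Arguments simplex_facet R {n} i.

(* Main.v *)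
Require Import Defs.
From mathcomp Require Import all_boot all_order all_algebra zify ring lra.

(** Write K for the product of the two simplices. In the open case choose
    continuous functions f_ij >= 0 on K, positive exactly on A_ij, and let r_i
    and c_j be the row and column sums and s > 0 the total sum of (f_ij). Since
    r_i vanishes where x_i = 0 and c_j where y_j = 0, any fixed point of the map
    sending (x, y) to the normalization of the pair
      ((x_i + s a_i / m - r_i)^+, (y_j + s / m - c_j)^+)
    satisfies r_i = s a_i / m and c_j = s / m. At such a point Hall's theorem,
    with capacities a_i, gives sigma with all f_(sigma j) j > 0.

    The fixed point comes from one simplex with n m vertices: its points z are
    matrices, (x, y) are the row and column sums of z, and the product of the
    two normalized vectors is again such a matrix. The set of z whose entry k
    is not decreased by this map is closed and these sets cover the simplex, so
    a KKM-type theorem yields a z none of whose entries decreases, hence a fixed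
    point. The KKM-type theorem is the limit of a combinatorial statement on
    grids, proved by Scarf's parity argument on sets dominant for a family of
    linear orders (see also Petri and Voorneveld, "No bullying!").

    The closed case follows from the open one for the e-neighbourhoods of the
    A_ij, minus the facets, by compactness as e tends to 0. *)

Set Implicit Arguments.
Unset Strict Implicit.

(** * Hall's theorem with capacities *)

(** Induction on the size of [X]. If some nonempty proper subset [Y] attains equality, [Y] and the
    rest of [X] are matched separately. Otherwise every such subset has a unit to spare, so one
    element can be assigned to any neighbour of positive capacity. *)
Lemma hall_capacity (I J : finType) (i0 : I) (e : I -> J -> bool) (X : {set J})
    (b : I -> nat) :
  (forall Y : {set J}, Y \subset X ->
    #|Y| <= \sum_(i | [exists j in Y, e i j]) b i) ->
  exists s : J -> I,
    (forall j, j \in X -> e (s j) j) /\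
    (forall i, #|[set j in X | s j == i]| <= b i).
Proof.
have [k] := ubnP #|X|; elim: k X b => // k IHk X b ltXk hall.
have [X0|[j1 Xj1]] := set_0Vmem X.
  exists (fun=> i0); split=> [j|i]; first by rewrite X0 inE.
  rewrite (_ : [set j in X | i0 == i] = set0) ?cards0 //.
  by apply/setP => j; rewrite X0 !inE.
have [/existsP[Y /and4P[YX Yn0 YnX /eqP Ytight]]|ntight] :=
  boolP [exists Y : {set J}, [&& Y \subset X, Y != set0, Y != X &
           #|Y| == \sum_(i | [exists j in Y, e i j]) b i]].
- have YpX : Y \proper X by rewrite properEneq YnX.
  have [||s1 [s1e s1b]] := IHk Y b.
  + by have := proper_card YpX; lia.
  + by move=> Z ZY; apply: hall; apply: subset_trans YX.
  (* The neighbours of [Y] are reserved for [Y]. Subtracting the equality for [Y] from the condition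
     for [Z :|: Y] gives the condition for [Z] with the capacities that remain. *)
  pose b' i := if [exists j in Y, e i j] then 0 else b i.
  have cXY : #|X :\: Y| + #|Y| = #|X|.
    by rewrite -(cardsID Y X) (setIidPr YX) addnC.
  have Y0 : 0 < #|Y| by rewrite card_gt0.
  have [||s2 [s2e s2b]] := IHk (X :\: Y) b'.
  + by lia.
  + move=> Z ZXY.
    have := hall (Z :|: Y).
    rewrite subUset YX andbT (subset_trans ZXY (subsetDl _ _)) => /(_ isT).
    have -> : #|Z :|: Y| = #|Z| + #|Y|.
      have /setDidPl ZY : [disjoint Z & Y].
        by have := ZXY; rewrite subsetD => /andP[].
      by rewrite -(cardsID Y) setIUl setIid setUC setDUl setDv setU0 ZY
                 (setUidPl (subsetIr _ _)) addnC.
    rewrite Ytight.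
    rewrite [leqRHS](bigID (fun i => [exists j in Y, e i j])) /= => le1.
    have : \sum_(i | [exists j in Z :|: Y, e i j] && [exists j in Y, e i j]) b i
           = \sum_(i | [exists j in Y, e i j]) b i.
      apply: eq_bigl => i; apply: andb_idl => /exists_inP[j Yj eij].
      by apply/exists_inP; exists j; rewrite // inE Yj orbT.
    have : \sum_(i | [exists j in Z :|: Y, e i j] && ~~ [exists j in Y, e i j]) b i
           <= \sum_(i | [exists j in Z, e i j]) b' i.
      rewrite [leqRHS]big_mkcond [leqLHS]big_mkcond; apply: leq_sum => i _.
      rewrite /b'; case: ifP => // /andP[/exists_inP[j + eij] nY].
      rewrite inE => /orP[Zj|Yj].
        by rewrite (negbTE nY) ifT //; apply/exists_inP; exists j.
      by case/negP: nY; apply/exists_inP; exists j.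
    by move=> H2 H1; move: le1; rewrite H1 addnC leq_add2l => /leq_trans; apply.
  exists (fun j => if j \in Y then s1 j else s2 j); split=> [j Xj|i].
    by case: ifPn => Yj; [apply: s1e|apply: s2e; rewrite inE Yj].
  have [iY|niY] := boolP [exists j in Y, e i j].
  + apply: leq_trans (s1b i); apply: subset_leq_card; apply/subsetP => j.
    rewrite !inE => /andP[Xj]; case: ifPn => //= nYj sj.
    have := s2b i; rewrite /b' iY leqn0 cards_eq0 => /eqP/setP/(_ j).
    by rewrite !inE nYj Xj sj.
  + have := s2b i; rewrite /b' (negbTE niY); apply: leq_trans.
    apply: subset_leq_card; apply/subsetP => j.
    rewrite !inE => /andP[Xj]; case: ifPn => Yj /eqP sj; last by rewrite Xj sj eqxx.
    by case/negP: niY; apply/exists_inP; exists j => //; rewrite -sj; apply: s1e.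
have /negP := ntight; move=> {}ntight.
have [i1 ei1 bi1] : exists2 i, e i j1 & 0 < b i.
  have := hall [set j1]; rewrite sub1set Xj1 cards1 => /(_ isT).
  rewrite lt0n sum_nat_eq0 => /forallPn[i]; rewrite negb_imply.
  move=> /andP[/exists_inP[j /set1P-> eij] bi].
  by exists i; rewrite // lt0n.
pose b' i := if i == i1 then (b i).-1 else b i.
have cX : #|X| = (#|X :\ j1|).+1 by rewrite (cardsD1 j1 X) Xj1.
have [||s [se sb]] := IHk (X :\ j1) b'.
- by lia.
- move=> Z ZX.
  have [->|Zn0] := eqVneq Z set0; first by rewrite cards0.
  have ZX' : Z \subset X := subset_trans ZX (subsetDl _ _).
  (* As [Z] is not tight, the strict inequality pays for the unit that [i1] loses. *)
  have lt : #|Z| < \sum_(i | [exists j in Z, e i j]) b i.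
    rewrite ltn_neqAle hall // andbT; apply/negP => eqZ; apply: ntight.
    apply/existsP; exists Z; rewrite ZX' Zn0 eqZ andbT /=.
    by apply/eqP => ZE; have := subset_leq_card ZX; rewrite ZE; lia.
  have le : \sum_(i | [exists j in Z, e i j]) b i <=
            \sum_(i | [exists j in Z, e i j]) b' i + \sum_i (i == i1).
    rewrite [leqLHS]big_mkcond [X in _ <= X + _]big_mkcond -big_split /=.
    by apply: leq_sum => i _; rewrite /b'; case: ifP; case: eqP => //=; lia.
  have : \sum_i (i == i1) = 1.
    by rewrite (bigD1 i1) //= eqxx big1 // => i /negbTE->.
  by lia.
exists (fun j => if j == j1 then i1 else s j); split=> [j Xj|i].
  by case: eqP => [->//|/eqP jj1]; apply: se; rewrite !inE jj1.
have := sb i; rewrite /b'; case: (eqVneq i i1) => [->|ii1].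
  move=> sb1; rewrite (cardsD1 j1) !inE eqxx Xj1 /=.
  suff -> : [set j in X | (if j == j1 then i1 else s j) == i1] :\ j1
            = [set j in X :\ j1 | s j == i1] by lia.
  by apply/setP => j; rewrite !inE; case: eqP.
apply: leq_trans; apply: subset_leq_card; apply/subsetP => j.
by rewrite !inE; case: (j == j1); rewrite // eq_sym (negbTE ii1) andbF.
Qed.

(** * Scarf's lemma *)

(** Scarf's condition: no element [y] lies, in every one of the orders, strictly above some element
    of [S]. *)
Definition dominant (I X : finType) (r : I -> X -> nat) (S : {set X}) :=
  [forall y, exists i, forall x in S, r i y <= r i x].

Lemma dominantP (I X : finType) (r : I -> X -> nat) (S : {set X}) :
  reflect (forall y, exists i, forall x, x \in S -> r i y <= r i x)
          (dominant r S).
Proof.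
apply: (iffP forallP) => dS y.
  by have /existsP[i /forall_inP ?] := dS y; exists i.
by have [i yi] := dS y; apply/existsP; exists i; apply/forall_inP.
Qed.

Lemma dominantS (I X : finType) (r : I -> X -> nat) (S R : {set X}) :
  S \subset R -> dominant r R -> dominant r S.
Proof.
move=> /subsetP SR /dominantP dR; apply/dominantP => y.
by have [i yi] := dR y; exists i => x /SR/yi.
Qed.

(** There is one more order than there are elements of [S], so two orders share their minimum. For
    each of these two orders there is exactly one new element that replaces the minimum in that
    order and in no other; the last hypothesis ensures that candidates exist. *)
Lemma card_pivots (I X : finType) (r : I -> X -> nat) (S : {set X}) :
  (forall i, injective (r i)) ->
  dominant r S -> #|S|.+1 = #|I| -> S != set0 ->
  (forall i i' x, i != i' -> x \in S ->
     (forall y, y \in S -> r i x <= r i y /\ r i' x <= r i' y) ->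
     exists y, forall k, k != i -> exists2 z, z \in S & r k z < r k y) ->
  #|[set x in ~: S | dominant r (x |: S)]| = 2.
Proof.
move=> injr /dominantP dS cS /set0Pn[s0 Ss0] hyp.
pose m i := [arg min_(x < s0 in S) r i x].
have mS i : m i \in S by rewrite /m; case: arg_minnP.
have mle i x : x \in S -> r i (m i) <= r i x.
  by rewrite /m; case: arg_minnP => // y Sy ymin /ymin.
have mE i y : y \in S -> (forall x, x \in S -> r i y <= r i x) -> y = m i.
  by move=> Sy ymin; apply: (injr i); apply/eqP; rewrite eqn_leq ymin ?mS //= mle.
have onto (L : {set I}) : (forall y, y \in S -> exists2 i, i \in L & y = m i) ->
    #|S| <= #|L| /\ (#|L| = #|S| -> {in L &, injective m}).
  move=> surj; have -> : S = m @: L.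
    apply/eqP; rewrite eqEsubset; apply/andP; split; apply/subsetP => y.
      by move=> /surj[i Li ->]; apply: imset_f.
    by case/imsetP => i _ ->.
  split; first exact: leq_imset_card.
  by move=> /esym/eqP/imset_injP.
have [i1 [i2 [i12 m12]]] : exists i1 i2, i1 != i2 /\ m i1 = m i2.
  have /injectivePn[i1 [i2 ? ?]] : ~~ injectiveb m; last by exists i1, i2.
  apply/negP => /injectiveP injm.
  have : #|m @: [set: I]| <= #|S|.
    by apply/subset_leq_card/subsetP => y /imsetP[i _ ->].
  by rewrite card_imset // cardsT; lia.
have cI1 (k : I) : #|~: [set k]| = #|S|.
  by rewrite cardsC1 -cS.
have ontoS y : y \in S -> exists i, y = m i.
  by move=> Sy; have [i yi] := dS y; exists i; apply: mE.
(* the minima of [x |: S] can only change in one of the two directions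
   sharing the same minimum over [S] *)
have other x : x \notin S -> dominant r (x |: S) ->
    exists2 k, k \in [set i1; i2] &
      forall l, l != k -> r l (m l) < r l x.
  move=> nSx /dominantP dx.
  have [k xk] := dx x.
  (* Each element of [S] stays the minimum of [x |: S] in some order. This uses at least [#|S|]
     orders, while [x] is the minimum in order [k]; hence the orders kept are exactly those other
     than [k], and [m] is injective on them. *)
  have surj : forall y, y \in S ->
      exists2 i, i \in [set l | r l (m l) < r l x] & y = m i.
    move=> y Sy; have [l yl] := dx y; have ym : y = m l.
      by apply: mE => // z Sz; apply: yl; rewrite inE Sz orbT.
    exists l => //; rewrite inE -ym ltn_neqAle yl ?setU11 // andbT.
    by apply/eqP => /injr yx; rewrite -yx Sy in nSx.
  have [le inj] := onto _ surj.
  have Lk : [set l | r l (m l) < r l x] \subset ~: [set k].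
    apply/subsetP => l; rewrite !inE => lt; apply/eqP => lk; subst l.
    by have := xk (m k); rewrite inE mS orbT => /(_ isT); lia.
  have LE : [set l | r l (m l) < r l x] = ~: [set k].
    by apply/eqP; rewrite eqEcard Lk cI1.
  rewrite LE in inj; exists k.
    rewrite !inE; apply/negPn/negP; rewrite negb_or => /andP[k1 k2].
    by case/eqP: i12; apply: (inj (cI1 k)) => //; rewrite !inE eq_sym.
  by move=> l nlk; have /setP/(_ l) := LE; rewrite !inE nlk.
have pivot i i' : i != i' -> m i = m i' -> exists x,
   [/\ x \notin S, dominant r (x |: S), r i x < r i (m i),
       (forall k, k != i -> r k (m k) < r k x) &
       forall y, y \notin S -> dominant r (y |: S) ->
          (forall l, l != i -> r l (m l) < r l y) -> y = x].
  move=> ii' mii'.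
  have ontoi y : y \in S -> exists2 k, k != i & y = m k.
    move=> /ontoS[k ->]; have [->|] := eqVneq k i; last by exists k.
    by exists i'; rewrite 1?eq_sym.
  (* [M] holds the candidates, above the minima of [S] in all orders but [i]. Only the highest of
     them in order [i] can be added, since any higher candidate would violate dominance. *)
  pose M := [set y | [forall (k | k != i), r k (m k) < r k y]].
  have MP y : reflect (forall k, k != i -> r k (m k) < r k y) (y \in M).
    by rewrite inE; apply: (iffP forall_inP).
  have [x0 Mx0] : exists x0, x0 \in M.
    have [y Sy|y yP] := hyp i i' (m i) ii' (mS i).
      by rewrite mle // mii' mle.
    exists y; apply/MP => k /yP[z Sz]; apply: leq_ltn_trans; exact: mle.
  have MS y : y \in M -> y \notin S.
    move=> /MP yM; apply/negP => /ontoi[k ki yk].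
    by have := yM k ki; rewrite -yk ltnn.
  have Mi y : y \in M -> r i y < r i (m i).
    move=> My; have [k yk] := dS y.
    have ki : k = i.
      apply/eqP/negPn/negP => ki.
      by have := yk _ (mS k); have /MP/(_ k ki) := My; lia.
    subst k; rewrite ltn_neqAle yk ?mS // andbT; apply/eqP => /injr ym.
    by have := MS y My; rewrite ym mS.
  case: (@arg_maxnP _ x0 (mem M) (r i) Mx0) => x Mx xmax.
  have {}xmax y : y \in M -> r i y <= r i x by apply: xmax.
  exists x; split=> //; [exact: MS|apply/dominantP => y|exact: Mi|exact/MP|].
    have [My|nMy] := boolP (y \in M).
      exists i => z; rewrite !inE => /orP[/eqP->|Sz]; first exact: xmax.
      by apply: leq_trans (ltnW (Mi y My)) _; apply: mle.
    move: nMy; rewrite inE negb_forall => /existsP[k].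
    rewrite negb_imply -leqNgt => /andP[ki yk].
    exists k => z; rewrite !inE => /orP[/eqP->|Sz].
      by apply: leq_trans yk _; apply: ltnW; apply/MP: k ki.
    by apply: leq_trans yk _; apply: mle.
  move=> y nSy /dominantP dy /MP My; apply: (injr i); apply/eqP.
  rewrite eqn_leq xmax //=; have [l xl] := dy x.
  have [li|li] := eqVneq l i; first by rewrite -li xl ?setU11.
  have := xl (m l); rewrite inE mS orbT => /(_ isT).
  by have /MP/(_ l li) := Mx; lia.
have [x1 [nSx1 dx1 lt1 gt1 uniq1]] := pivot i1 i2 i12 m12.
have i21 : i2 != i1 by rewrite eq_sym.
have [x2 [nSx2 dx2 lt2 gt2 uniq2]] := pivot i2 i1 i21 (esym m12).
have x12 : x1 != x2.
  by apply/eqP => x12; subst x2; have := gt2 i1 i12; lia.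
rewrite (_ : [set x in ~: S | dominant r (x |: S)] = [set x1; x2]) ?cards2 ?x12 //.
apply/setP => x; rewrite in_set !in_set2 in_setC.
apply/andP/orP => [[nSx dx]|[/eqP->|/eqP->]] //.
have [k + gtk] := other x nSx dx.
by rewrite !inE => /orP[/eqP kE|/eqP kE]; subst k; [left|right]; apply/eqP; auto.
Qed.

(* [inr k] is a slack element, lowest for the order [k] and above all points
   of [T] for the others *)
Definition slack_rank (I T : finType) (r : I -> T -> nat) (i : I) (x : T + I) :=
  match x with
  | inl t => (r i t).+1
  | inr k => if k == i then 0 else (\max_t r i t).+2 + enum_rank k
  end.

Lemma slack_rank_inj (I T : finType) (r : I -> T -> nat) i :
  injective (r i) -> injective (slack_rank r i).
Proof.
move=> injr [t|k] [t'|k'] /=.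
- by case=> /injr->.
- case: ifP => // _; have := @leq_bigmax _ (r i) t; lia.
- case: ifP => // _; have := @leq_bigmax _ (r i) t'; lia.
- case: eqP => [->|_]; case: eqP => [->|_] // /eqP.
  by rewrite eqn_add2l => /eqP/val_inj/enum_rank_inj->.
Qed.

Lemma even_sum (I : finType) (F : I -> nat) :
  (forall i, ~~ odd (F i)) -> ~~ odd (\sum_i F i).
Proof.
move=> evenF; elim/big_ind: _ => // x y.
by rewrite oddD => /negbTE-> /negbTE->.
Qed.

(** The number is 0 or 2. If removing [x] leaves exactly the colours other than [i0], then [x] does
    not have colour [i0], as [R] misses a colour. So [x] shares its colour with one other element,
    and these two are the only elements that can be removed. *)
Lemma even_almost_rainbow (I X : finType) (c : X -> I) (i0 : I) (R : {set X}) :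
  #|R| = #|I| -> c @: R != setT ->
  ~~ odd #|[set x in R | c @: (R :\ x) == ~: [set i0]]|.
Proof.
move=> cR ncR.
have [->|[x]] := set_0Vmem [set x in R | c @: (R :\ x) == ~: [set i0]].
  by rewrite cards0.
have inj y : y \in R -> c @: (R :\ y) = ~: [set i0] -> {in R :\ y &, injective c}.
  move=> Ry cy; apply/imset_injP; rewrite cy cardsC1.
  by have := cardsD1 y R; rewrite Ry -cR => ->.
rewrite inE => /andP[Rx /eqP cx].
have cxi0 : c x != i0.
  apply: contra ncR => /eqP cxi0.
  by rewrite -(setD1K Rx) imsetU1 cx cxi0 setUCr.
have /imsetP[x' Rx' cxx'] : c x \in c @: (R :\ x) by rewrite cx !inE.
have xx' : x != x' by move: Rx'; rewrite !inE eq_sym => /andP[].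
suff -> : [set y in R | c @: (R :\ y) == ~: [set i0]] = [set x; x'].
  by rewrite cards2 xx'.
have Rx'' : x' \in R by move: Rx'; rewrite inE => /andP[].
apply/setP => y; rewrite in_set2 in_set.
apply/andP/orP => [[Ry /eqP cy]|[/eqP->|/eqP->]]; last 2 first.
- by rewrite cx eqxx.
- split=> //; rewrite -cx; apply/eqP/setP => i.
  apply/imsetP/imsetP => -[z + ->]; rewrite !inE => /andP[zn Rz].
    have [->|zx] := eqVneq z x; last by exists z; rewrite // !inE zx.
    by exists x'; rewrite // !inE eq_sym xx'.
  have [->|zx] := eqVneq z x'; last by exists z; rewrite // !inE zx.
  by exists x; rewrite // !inE xx'.
apply/orP; rewrite -[_ || _]negbK negb_or; apply/negP => /andP[yx yx'].
case/eqP: xx'; apply: (inj y Ry cy) => //; rewrite !inE eq_sym ?yx ?yx' //.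
Qed.

(** Call a dominant set of size [#|I|] a room, and a room minus one element a door if its colours
    are all but [i0]. Incidences of rooms and doors are counted twice: without a rainbow room every
    room has an even number of doors, yet every door lies in two rooms except one, which lies in a
    single room. *)
Lemma scarf (I T : finType) (r : I -> T -> nat) (c : T -> I) :
  (forall i, injective (r i)) -> 0 < #|T| ->
  exists S : {set T + I}, dominant (slack_rank r) S /\
    forall i, exists2 x, x \in S & (match x with inl t => c t | inr k => k end) = i.
Proof.
move=> injr T_gt0.
pose c' (x : T + I) := match x with inl t => c t | inr k => k end.
case: (pickP (fun S : {set T + I} => dominant (slack_rank r) S && (c' @: S == setT))).
  move=> S /andP[dS /eqP cS]; exists S; split=> // i.
  by have : i \in c' @: S by [rewrite cS inE]; case/imsetP => x ? ->; exists x.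
move=> noR; exfalso.
have /card_gt0P[t0 _] := T_gt0.
pose i0 := c t0.
pose q := slack_rank r.
have injq i : injective (q i) by apply: slack_rank_inj.
pose P := [set p : {set T + I} * (T + I) | [&& p.2 \in p.1, dominant q p.1,
             #|p.1| == #|I| & c' @: (p.1 :\ p.2) == ~: [set i0]]].
have evenP : ~~ odd #|P|.
  have -> : #|P| = \sum_(R : {set T + I}) #|[set x | (R, x) \in P]|.
    rewrite -sum1_card (partition_big fst xpredT) //=; apply: eq_bigr => R _.
    rewrite -sum1_card (reindex_onto (fun x => (R, x)) snd) /=; last first.
      by case=> R' x /andP[_ /eqP/= ->].
    by apply: eq_bigl => x; rewrite !inE !eqxx !andbT.
  apply: even_sum => R.
  have [dR|ndR] := boolP (dominant q R && (#|R| == #|I|)); last first.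
    rewrite (_ : [set x | (R, x) \in P] = set0) ?cards0 //.
    apply/setP => x; rewrite !inE /=; apply/negbTE.
    by apply: contra ndR => /and4P[_ -> -> _].
  have /andP[dR' /eqP cR] := dR.
  have -> : [set x | (R, x) \in P] = [set x in R | c' @: (R :\ x) == ~: [set i0]].
    by apply/setP => x; rewrite !inE /= dR' cR eqxx.
  apply: even_almost_rainbow => //.
  by have := noR R; rewrite -/q dR' /= => /negbT.
(* the only door lying in an odd number of rooms *)
pose S0 : {set T + I} := inr @: ~: [set i0].
have mem_inl t : inl t \in S0 = false.
  by apply/negbTE/negP => /imsetP[].
have mem_inr k : inr k \in S0 = (k != i0).
  by rewrite mem_imset ?inE // => ? ? [].
pose F (S : {set T + I}) := #|[set p in P | p.1 :\ p.2 == S]|.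
have FE (S : {set T + I}) : c' @: S = ~: [set i0] -> #|S|.+1 = #|I| ->
    F S = #|[set x in ~: S | dominant q (x |: S)]|.
  move=> cS cardS; rewrite -(card_imset (f := fun x => (x |: S, x))); last first.
    by move=> x y [].
  congr #|pred_of_set _|; apply/setP => -[R x]; rewrite !inE /=.
  apply/idP/imsetP => [/andP[/and4P[Rx dR _ _] /eqP <-]|[y + [-> ->]]].
    by exists x; rewrite ?setD1K // !inE eqxx setD1K.
  rewrite !inE => /andP[nSy dR]; rewrite eqxx dR /= setU1K // cS !eqxx !andbT.
  by rewrite cardsU1 nSy add1n cardS.
have cS0 : c' @: S0 = ~: [set i0].
  by rewrite -imset_comp (eq_imset (g := id)) ?imset_id.
have cardS0 : #|S0|.+1 = #|I|.
  rewrite card_imset; last by move=> ? ? [].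
  by rewrite cardsC1 prednK //; apply/card_gt0P; exists i0.
have F0 : F S0 = 1.
  rewrite FE //.
  (* In each order other than [i0] the slack elements of [S0] already supply the bottom, so only
     order [i0] can dominate points of [T]. The one completion is therefore the highest point in
     that order. *)
  pose t1 := [arg max_(t > t0) r i0 t].
  have t1max t : r i0 t <= r i0 t1.
    by rewrite /t1; case: arg_maxnP => // t' _; apply.
  apply/eqP/cards1P; exists (inl t1); apply/setP => x; rewrite !inE.
  apply/andP/eqP => [[nS0x /dominantP dx]|->].
    case: x nS0x dx => [t|k] nS0x dx.
      congr inl; apply: (injr i0); apply/eqP; rewrite eqn_leq t1max /=.
      have [i] := dx (inl t1); have [->|ii0] := eqVneq i i0.
        by move=> /(_ (inl t)); rewrite setU11 => /(_ isT).
      move=> /(_ (inr i)); rewrite inE mem_inr ii0 orbT => /(_ isT).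
      by rewrite /q /= eqxx.
    move: nS0x; rewrite mem_inr negbK => /eqP kE; subst k.
    have [i] := dx (inl t0) => /(_ (inr i)).
    by rewrite !inE mem_inr (inj_eq (@inr_inj _ _)) orbN /q /= eqxx => /(_ isT).
  rewrite mem_inl; split=> //; apply/dominantP => -[t|k].
    exists i0 => -[t'|k']; rewrite !inE ?mem_inl ?mem_inr /= ?orbF.
      by rewrite (inj_eq (@inl_inj _ _)) => /eqP->; rewrite ltnS t1max.
    by rewrite /q /= => /negbTE->; have := @leq_bigmax _ (r i0) t; lia.
  by exists k => y _; rewrite /q /= eqxx.
have evenF S : S != S0 -> ~~ odd (F S).
  move=> SS0.
  have [/and3P[dS /eqP cardS /eqP cS]|nS] :=
    boolP [&& dominant q S, #|S|.+1 == #|I| & c' @: S == ~: [set i0]]; last first.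
    rewrite /F (_ : [set _ in P | _] = set0) ?cards0 //.
    apply/setP => -[R x]; rewrite !inE /=; apply/negbTE; apply: contra nS.
    move=> /andP[/and4P[Rx dR /eqP cR ccR] /eqP<-].
    rewrite ccR andbT (dominantS _ dR) ?subsetDl // -cR.
    by rewrite [in eqbRHS](cardsD1 x) Rx add1n eqxx.
  rewrite FE //.
  (* A door made of slack elements only would contain every colour but [i0], hence be [S0]. *)
  have [t St] : exists t, inl t \in S.
    apply/existsP; apply: contraNT SS0 => /existsPn nt.
    apply/eqP/setP => -[t|k]; first by rewrite mem_inl; apply/negbTE/nt.
    rewrite mem_inr; apply/idP/idP => [Sk|ki0].
      have : c' (inr k) \in c' @: S by apply: imset_f.
      by rewrite cS !inE.
    have : k \in c' @: S by rewrite cS !inE.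
    by case/imsetP => -[t|k'] Sx /= ->; rewrite ?(negbTE (nt t)) in Sx *.
  rewrite card_pivots //; first by apply/set0Pn; exists (inl t).
  (* In an order [k] other than [i], the slack element [inr i] is above [inr k] and above all points
     of [T], and [S] contains one of these. *)
  move=> i i' x ii' Sx xmin; exists (inr i) => k ki.
  have [Sk|nSk] := boolP (inr k \in S).
    by exists (inr k) => //; rewrite /q /= eqxx eq_sym (negbTE ki).
  exists (inl t) => //; rewrite /q /= eq_sym (negbTE ki).
  by have := @leq_bigmax _ (r k) t; lia.
have : odd #|P|.
  have -> : #|P| = \sum_(S : {set T + I}) F S.
    rewrite -sum1_card (partition_big (fun p => p.1 :\ p.2) xpredT) //=.
    apply: eq_bigr => S _; rewrite sum1dep_card /F.
    by apply: eq_card => p; rewrite !inE.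
  rewrite (bigD1 S0) //= F0 add1n /= big_mkcond /=.
  by apply: even_sum => S; case: ifP => // /evenF.
by rewrite (negbTE evenP).
Qed.

(** Scarf's lemma is applied to the grid points of sum [k], ordered by each coordinate. Dominance
    confines the grid points of the rainbow set to a box of side [N]; a colour is carried either by
    one of them or by a slack element, and then that coordinate is small throughout the box. *)
Lemma rainbow_grid (N k : nat) (c : ('I_N -> nat) -> 'I_N) : 0 < N ->
  exists v : 'I_N -> nat, \sum_i v i = k /\
    forall i, v i <= N \/
      exists u : 'I_N -> nat, [/\ \sum_i u i = k, c u = i &
        forall l, u l <= v l + N /\ v l <= u l + N].
Proof.
move=> N_gt0; pose i0 := Ordinal N_gt0.
pose T : finType := {u : {ffun 'I_N -> 'I_k.+1} | \sum_i u i == k}.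
pose p (t : T) (i : 'I_N) : nat := val t i.
have sump t : \sum_i p t i = k by apply/eqP/(valP t).
have mkT (y : 'I_N -> nat) : \sum_i y i = k -> exists t, p t =1 y.
  move=> sumy.
  have yk i : (inord (y i) : 'I_k.+1) = y i :> nat.
    by rewrite inordK // ltnS -sumy (bigD1 i) //= leq_addr.
  pose f : {ffun 'I_N -> 'I_k.+1} := [ffun i => inord (y i)].
  have Pf : \sum_i f i == k.
    by apply/eqP; rewrite -[RHS]sumy; apply: eq_bigr => i _; rewrite ffunE yk.
  exists (exist (fun u : {ffun 'I_N -> 'I_k.+1} => \sum_i u i == k) f Pf).
  by move=> i; rewrite /p /= ffunE yk.
have [t0 _] : exists t, p t =1 (fun i => (i == i0) * k).
  apply: mkT; rewrite (bigD1 i0) //= ?eqxx mul1n big1 ?addn0 //.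
  by move=> i /negbTE->.
(* Ties between equal coordinates are broken by the enumeration of [T], so that each order is
   injective. *)
pose r i (t : T) := p t i * #|T| + enum_rank t.
have rlt i t t' : p t i < p t' i -> r i t < r i t'.
  move=> lt; apply: leq_trans (_ : (p t i).+1 * #|T| <= _).
    by rewrite /r mulSn addnC ltn_add2r ltn_ord.
  by rewrite /r; apply: leq_trans (leq_addr _ _); rewrite leq_mul2r lt orbT.
have rinj i : injective (r i).
  move=> t t' /(congr1 (modn^~ #|T|)); rewrite /r !modnMDl !modn_small //.
  by move=> /val_inj/enum_rank_inj.
have T_gt0 : 0 < #|T| by apply/card_gt0P; exists t0.
have [S [/dominantP dS surj]] := scarf (fun t => c (p t)) rinj T_gt0.
have surjC i : inr i \notin S -> exists2 t, inl t \in S & c (p t) = i.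
  move=> nSi; have [[t|k'] Sx xi] := surj i; first by exists t.
  by move: nSi; rewrite -xi Sx.
have dC t : exists2 i, inr i \notin S & forall t', inl t' \in S -> r i t <= r i t'.
  have [i ti] := dS (inl t); exists i => [|t' /ti//].
  by apply/negP => /ti; rewrite /= eqxx.
have [t1 St1] : exists t, inl t \in S.
  by have [i /surjC[t ? _] _] := dC t0; exists t.
pose mt i := [arg min_(t < t1 | inl t \in S) r i t].
(* The lower corner of the box that contains the grid points of [S]. *)
pose a i := if inr i \in S then 0 else p (mt i) i.
have Smt i : inl (mt i) \in S by rewrite /mt; case: arg_minnP.
have ale i t : inl t \in S -> a i <= p t i.
  move=> St; rewrite /a; case: ifP => // _; rewrite leqNgt; apply/negP => /rlt.
  by rewrite /mt; case: arg_minnP => // t' _ /(_ t St); lia.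
have suma : k < \sum_(i | inr i \notin S) (a i).+1.
  rewrite ltnNge; apply/negP => le.
  pose s := \sum_(i | inr i \notin S) (a i).+1.
  (* Otherwise there is room for a grid point exceeding [a] in every coordinate without slack, the
     surplus [k - s] being put on [i0]; it contradicts dominance. *)
  have [t tE] : exists t, p t =1 (fun i =>
      (if inr i \notin S then (a i).+1 else 0) + (i == i0) * (k - s)).
    apply: mkT; rewrite big_split /= -big_mkcond -/s [X in _ + X](bigD1 i0) //=.
    rewrite ?eqxx mul1n [X in _ + (_ + X)]big1 ?addn0 ?subnKC //.
    by move=> i /negbTE->.
  have [i nSi /(_ _ (Smt i))] := dC t.
  by rewrite leqNgt rlt // tE nSi /a (negbTE nSi); lia.
(* The coordinates of [t] sum to [k], which is less than the sum of [a] plus [N], and none of them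
   is below [a]. *)
have near t l : inl t \in S -> p t l <= a l + N.
  move=> St; have le : \sum_(i | i != l) a i <= \sum_(i | i != l) p t i.
    by apply: leq_sum => i _; apply: ale.
  have := sump t; rewrite (bigD1 l) //=.
  have : \sum_(i | inr i \notin S) (a i).+1 <= \sum_i a i + N.
    rewrite big_mkcond /= -[X in _ + X]card_ord -sum1_card -big_split /=.
    by apply: leq_sum => i _; case: ifP; rewrite addn1.
  rewrite [X in _ <= X + _](bigD1 l) //= => /(leq_trans suma).
  by move: le; set A := \sum_(i | _) a i; set B := \sum_(i | _) p t i; lia.
exists (p t1); split=> // i.
have [Si|/surjC[t St tc]] := boolP (inr i \in S).
  by left; have := near t1 i St1; rewrite /a Si.
right; exists (p t); split=> // l.
by have := near t l St; have := near t1 l St1; have := ale l t St;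
   have := ale l t1 St1; lia.
Qed.

(** * From a transport matrix to an assignment *)

Import Order.TTheory GRing.Theory Num.Theory.

(** Hall's condition follows by weighing: the columns in [Y] have total mass [s * #|Y|], all of it
    in rows that meet [Y] in the support. The resulting fibres have at most [a i] elements, and
    equality holds because both sides sum to [m]. *)
Lemma transport_support (R : realFieldType) (n m : nat) (f : 'I_n -> 'I_m -> R)
    (s : R) (a : 'I_n -> nat) :
  0 < n -> (0 < s)%R -> (forall i j, 0 <= f i j)%R ->
  (forall i, \sum_j f i j = s * (a i)%:R)%R ->
  (forall j, \sum_i f i j = s)%R ->
  \sum_i a i = m ->
  exists sigma : 'I_m -> 'I_n, (forall i, #|sigma @^-1: pred1 i| = a i) /\
    forall j, (0 < f (sigma j) j)%R.
Proof.
move=> n0 s0 f0 fr fc suma.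
have [|sg [sgf sga]] := @hall_capacity _ _ (Ordinal n0)
    (fun i j => 0 < f i j)%R [set: 'I_m] a.
  move=> Y _; rewrite -(ler_nat R) -(ler_pM2l s0) natr_sum mulr_sumr.
  have -> : (s * #|Y|%:R = \sum_(j in Y) \sum_i f i j)%R.
    under eq_bigr do rewrite fc.
    by rewrite sumr_const mulr_natr.
  rewrite exchange_big /= [leRHS]big_mkcond; apply: ler_sum => i _.
  have [_|nY] := boolP [exists j in Y, (0 < f i j)%R].
    by rewrite -fr [leRHS](bigID (mem Y)) /= lerDl sumr_ge0.
  rewrite big1 // => j Yj; apply/eqP; rewrite eq_le f0 andbT leNgt.
  by apply: contra nY => fij; apply/exists_inP; exists j.
exists sg; split=> [i|j]; last by apply: sgf; rewrite inE.
have sgE k : [set j in [set: 'I_m] | sg j == k] = sg @^-1: pred1 k.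
  by apply/setP => j; rewrite !inE.
have le k : #|sg @^-1: pred1 k| <= a k by rewrite -sgE.
have sum_sg : \sum_k #|sg @^-1: pred1 k| = m.
  rewrite -[RHS]card_ord -sum1_card (partition_big sg xpredT) //=.
  by apply: eq_bigr => k _; rewrite sum1dep_card; apply: eq_card => j; rewrite !inE.
have := etrans sum_sg (esym suma); rewrite (bigD1 i) //= [RHS](bigD1 i) //=.
have : \sum_(k | k != i) #|sg @^-1: pred1 k| <= \sum_(k | k != i) a k.
  by apply: leq_sum => k _.
move=> leAB eqAB; apply/eqP; rewrite eqn_leq le /=.
by rewrite -(leq_add2r (\sum_(k | k != i) #|sg @^-1: pred1 k|)) eqAB leq_add2l.
Qed.

(** * Closed covers of a simplex *)

From mathcomp Require Import all_classical all_reals all_analysis.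
Import numFieldNormedType.Exports.
Local Open Scope classical_set_scope.
Local Open Scope ring_scope.
Unset Implicit Arguments.
Set Strict Implicit.

Lemma compact_cluster_seq (R : realType) (V : pseudoMetricType R) (K : set V)
    (p : nat -> V) :
  compact K -> (forall k, K (p k)) ->
  exists2 z, K z & forall e k0, 0 < e -> exists2 k, (k0 <= k)%N & ball z e (p k).
Proof.
move=> cK Kp; have [|z [Kz clz]] := cK (p @ \oo) _.
  by exists 0%N => // k _; apply: Kp.
exists z => // e k0 e0.
have [||_ [[k k0k <-] zk]] := clz (p @` [set k | (k0 <= k)%N]) (ball z e).
- by exists k0 => // k k0k; exists k.
- exact: nbhsx_ballx.
by exists k.
Qed.

Lemma continuous_sum (R : realType) (T : topologicalType) (I : finType)
    (F : I -> T -> R) :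
  (forall i, continuous (F i)) -> continuous (fun x => \sum_i F i x).
Proof.
move=> cF; apply: (@continuous_big R I +%R 0 xpredT) => [|i _]; last exact: cF.
exact: add_continuous.
Qed.

Lemma closed_le_fun (R : realType) (T : topologicalType) (f g : T -> R) :
  continuous f -> continuous g -> closed [set x | f x <= g x].
Proof.
move=> cf cg.
rewrite (_ : [set x | _] = (fun x => g x - f x) @^-1` [set y | 0 <= y]); last first.
  by apply/seteqP; split => x /=; rewrite subr_ge0.
apply: closed_comp; last exact: closed_ge.
by move=> x _; apply: cvgB; [apply: cg|apply: cf].
Qed.

Lemma compact_simplex (R : realType) (N : nat) : compact (simplex R N).
Proof.
have cc (i : 'I_N) : continuous (fun v : 'rV[R]_N => v ord0 i).
  exact: coord_continuous.
apply: (@subclosed_compact _ _ [set v : 'rV[R]_N | forall i, `[0, 1]%classic (v ord0 i)]).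
- rewrite (_ : simplex R N = [set v : 'rV[R]_N | \sum_i v ord0 i <= 1] `&`
      [set v : 'rV[R]_N | 1 <= \sum_i v ord0 i] `&`
      \bigcap_i [set v : 'rV[R]_N | 0 <= v ord0 i]); last first.
    apply/seteqP; split => v /=.
      move=> [v0 v1]; rewrite v1.
      by split; [split; rewrite /= lexx|move=> i _; exact: v0].
    move=> [[/= le ge] v0]; split=> [i|]; first exact: v0.
    by apply/eqP; rewrite eq_le le.
  have cs := continuous_sum _ _ _ _ cc.
  have cr (r : R) : continuous (fun=> r : R) := @cst_continuous 'rV[R]_N R r.
  apply: closedI; first apply: closedI.
  + exact: closed_le_fun cs (cr 1).
  + exact: closed_le_fun (cr 1) cs.
  + by apply: closed_bigI => i _; exact: closed_le_fun (cr 0) (cc i).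
- by apply: (@rV_compact R N (fun=> `[0, 1]%classic)) => i; exact: segment_compact.
move=> v [v0 v1] i /=; rewrite in_itv /= v0 /= -v1 (bigD1 i) //= lerDl.
by apply: sumr_ge0.
Qed.

(** Each point of the grid of mesh [1 / k.+1] is coloured by a set that contains it, and [z] is a
    cluster point of the points given by [rainbow_grid]. Where the coordinate [i] of [z] is
    positive, the alternative of a small coordinate fails for large [k], so points of [C i] come
    arbitrarily close to [z]. *)
Lemma dual_kkm (R : realType) (N : nat) (C : 'I_N -> set 'rV[R]_N) :
  (0 < N)%N -> (forall i, closed (C i)) ->
  (forall z, simplex R N z -> exists i, C i z) ->
  exists2 z, simplex R N z & forall i, z ord0 i = 0 \/ C i z.
Proof.
move=> N0 cC cov; pose i0 := Ordinal N0.
pose pt k (u : 'I_N -> nat) : 'rV[R]_N := \row_i ((u i)%:R / k.+1%:R).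
have ptP k u : (\sum_i u i = k.+1)%N -> simplex R N (pt k u).
  move=> su; split=> [i|]; first by rewrite mxE divr_ge0.
  under eq_bigr do rewrite mxE.
  by rewrite -mulr_suml -natr_sum su divff.
have [c cP] : exists c : nat -> ('I_N -> nat) -> 'I_N,
    forall k u, (\sum_i u i = k.+1)%N -> C (c k u) (pt k u).
  have : forall ku : nat * ('I_N -> nat), exists i,
      (\sum_i ku.2 i = ku.1.+1)%N -> C i (pt ku.1 ku.2).
    move=> [k u] /=; have [/ptP/cov[i Ci]|n] := pselect (\sum_i u i = k.+1)%N.
      by exists i.
    by exists i0.
  by move=> /choice[c cP]; exists (fun k u => c (k, u)) => k u; apply: (cP (k, u)).
have /choice[v vP] := fun k => rainbow_grid k.+1 (c k) N0.
have [|z sz zcl] := @compact_cluster_seq R 'rV[R]_N (simplex R N)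
    (fun k => pt k (v k)) (compact_simplex R N).
  by move=> k; apply: ptP; have [] := vP k.
exists z => // i; have [|zi] := eqVneq (z ord0 i) 0; [by left|right].
have {}zi : 0 < z ord0 i by rewrite lt_def zi; have [->] := sz.
apply: (cC i) => B /nbhs_ballP[e /= e0 zeB].
(* Both the distance from [z] to the grid point and the box side [N / k.+1] will be below [d]. The
   bound [e / 2] puts [u] within [e] of [z]; the bound by half the coordinate excludes
   [v k i <= N]. *)
pose d := Num.min (e / 2) (z ord0 i / 2).
have d0 : 0 < d by rewrite lt_min !divr_gt0.
have [de di] : d <= e / 2 /\ d <= z ord0 i / 2.
  by rewrite /d !ge_min !lexx orbT.
have [k k0k zk] := zcl d (Num.bound (N%:R / d)) d0.
clearbody d; have kN : N%:R / k.+1%:R < d.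
  rewrite ltr_pdivrMr // mulrC -ltr_pdivrMr //.
  apply: lt_le_trans (archi_boundP _) _; first by rewrite divr_ge0 // ltW.
  by rewrite ler_nat (leq_trans k0k).
have [_ /(_ i) [vN|[u [su cu uv]]]] := vP k.
  exfalso; have [_ zkE] := zk; have := zkE ord0 i; rewrite /ball /= mxE => zki.
  have : (v k i)%:R / k.+1%:R <= N%:R / k.+1%:R :> R.
    by rewrite ler_pM2r ?invr_gt0 // ler_nat.
  move: zki kN; rewrite ltr_norml => /andP[_].
  by move: (_ / _ : R) (N%:R / _ : R) => x y; lra.
exists (pt k u); split; first by rewrite -cu; apply: cP.
apply: zeB; split=> // a j; rewrite ord1 {a}.
have [_ zkE] := zk; have := zkE ord0 j; rewrite /ball /= !mxE => zkj.
have [u1 u2] := uv j.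
have h1 : (u j)%:R / k.+1%:R <= (v k j)%:R / k.+1%:R + N%:R / k.+1%:R :> R.
  by rewrite -mulrDl -natrD ler_pM2r ?invr_gt0 // ler_nat.
have h2 : (v k j)%:R / k.+1%:R <= (u j)%:R / k.+1%:R + N%:R / k.+1%:R :> R.
  by rewrite -mulrDl -natrD ler_pM2r ?invr_gt0 // ler_nat.
move: zkj h1 h2 kN; rewrite !ltr_norml => /andP[].
move: (_ / _ : R) ((u j)%:R / _ : R) (N%:R / _ : R) => x y w *.
by apply/andP; split; lra.
Qed.

(** * Matrices with prescribed row and column sums *)

Lemma continuous_row (R : realType) (T : topologicalType) (n : nat)
    (h : 'I_n -> T -> R) :
  (forall i, continuous (h i)) -> continuous (fun x => \row_i h i x : 'rV[R]_n).
Proof.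
move=> ch x; apply/cvg_ballP => e e0.
have : \forall y \near x, forall j, ball (h j x) e (h j y).
  by apply: filter_forall => j; apply: (cvg_ball (ch j x)).
by apply: filterS => y hy; split=> // a j; rewrite !mxE.
Qed.

Lemma continuous_mul (R : realType) (T : topologicalType) (f g : T -> R) :
  continuous f -> continuous g -> continuous (fun x => f x * g x).
Proof. by move=> cf cg x; apply: (@cvgM _ _ _ _ f g); [exact: cf|exact: cg]. Qed.

Lemma continuous_excess (R : realType) (T : topologicalType) (f g h : T -> R) (b : R) :
  continuous f -> continuous g -> continuous h ->
  continuous (fun x => Num.max 0 (f x + g x * b - h x)).
Proof.
move=> cf cg ch; apply: (@max_fun_continuous _ T R (fun=> 0)) => x.
  exact: cst_continuous.
apply: (@cvgB _ _ _ _ _ (fun x => f x + g x * b) h) (ch x).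
apply: (@cvgD _ _ _ _ _ f (fun x => g x * b)) (cf x) _.
apply: (@cvgM _ _ _ _ g (fun=> b)) (cg x) _.
exact: cst_continuous.
Qed.

(** The untruncated values sum to 1, so their positive parts sum to at least 1. At a fixed point
    every [t i] is nonzero: it is a positive multiple of [x i], or equals [s * b i] when [x i = 0].
    Hence nothing was truncated, the sum is exactly 1, and [x i] cancels. *)
Lemma fixed_balance (R : realType) (n : nat) (x b r : 'I_n -> R) (s : R) :
  0 < s -> (forall i, 0 <= x i) -> \sum_i x i = 1 ->
  (forall i, x i = 0 -> r i = 0) -> \sum_i r i = s ->
  (forall i, 0 < b i) -> \sum_i b i = 1 ->
  let t i := Num.max 0 (x i + s * b i - r i) in
  1 <= \sum_i t i /\
  ((forall i, x i * \sum_k t k = t i) -> forall i, r i = s * b i).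
Proof.
move=> s0 x0 x1 xr rs b0 b1 t.
have sumE : \sum_i (x i + s * b i - r i) = 1.
  by rewrite sumrB big_split /= -mulr_sumr x1 b1 rs; ring.
have S1 : 1 <= \sum_i t i.
  by rewrite -sumE; apply: ler_sum => i _; rewrite le_max lexx orbT.
split=> // fix_t.
have tE i : t i = x i + s * b i - r i.
  have : t i != 0.
    have [xi|xi] := eqVneq (x i) 0; last first.
      by rewrite -fix_t mulf_neq0 // gt_eqF // (lt_le_trans ltr01).
    by rewrite /t xi (xr i xi) subr0 add0r gt_eqF // lt_max mulr_gt0 ?orbT.
  by rewrite /t; case: (lerP 0 (x i + s * b i - r i)) => // _; rewrite eqxx.
have S1' : \sum_i t i = 1 by rewrite -sumE; apply: eq_bigr => i _; rewrite tE.
move=> i; have := fix_t i; rewrite S1' mulr1 tE; lra.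
Qed.

Lemma continuous_fst_coord (R : realType) (n m : nat) (i : 'I_n) :
  continuous (fun p : 'rV[R]_n * 'rV[R]_m => p.1 ord0 i).
Proof.
by move=> p; exact: (continuous_comp (@cvg_fst _ _ (nbhs p.1) (nbhs p.2) _)
                                     (@coord_continuous R 1 n ord0 i p.1)).
Qed.

Lemma continuous_snd_coord (R : realType) (n m : nat) (j : 'I_m) :
  continuous (fun p : 'rV[R]_n * 'rV[R]_m => p.2 ord0 j).
Proof.
by move=> p; exact: (continuous_comp (@cvg_snd _ _ (nbhs p.1) (nbhs p.2) _)
                                     (@coord_continuous R 1 m ord0 j p.2)).
Qed.

Lemma transport_point (R : realType) (n m : nat)
    (f : 'I_n -> 'I_m -> 'rV[R]_n * 'rV[R]_m -> R) (b : 'I_n -> R) (d : 'I_m -> R) :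
  (0 < n)%N -> (0 < m)%N ->
  (forall i j, continuous (f i j)) ->
  (forall i j p, 0 <= f i j p) ->
  (forall i j p, simplex R n p.1 -> simplex R m p.2 -> p.1 ord0 i = 0 -> f i j p = 0) ->
  (forall i j p, simplex R n p.1 -> simplex R m p.2 -> p.2 ord0 j = 0 -> f i j p = 0) ->
  (forall p, simplex R n p.1 -> simplex R m p.2 -> exists i j, 0 < f i j p) ->
  (forall i, 0 < b i) -> \sum_i b i = 1 ->
  (forall j, 0 < d j) -> \sum_j d j = 1 ->
  exists p s, [/\ simplex R n p.1 /\ simplex R m p.2, 0 < s,
    forall i, \sum_j f i j p = s * b i & forall j, \sum_i f i j p = s * d j].
Proof.
move=> n0 m0 cf f0 fx fy fpos b0 b1 d0 d1.
pose V := ('rV[R]_n * 'rV[R]_m)%type.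
pose ix : 'I_n -> 'I_m -> 'I_(n * m) := @mxvec_index n m.
have sum_ix (F : 'I_(n * m) -> R) : \sum_k F k = \sum_i \sum_j F (ix i j).
  rewrite (reindex _ (curry_mxvec_bij n m)) pair_big /=.
  by apply: eq_bigr => -[i j] _.
have sum_ix' (F : 'I_(n * m) -> R) : \sum_k F k = \sum_j \sum_i F (ix i j).
  by rewrite sum_ix exchange_big.
pose x (z : 'rV[R]_(n * m)) : 'rV[R]_n := \row_i \sum_j z ord0 (ix i j).
pose y (z : 'rV[R]_(n * m)) : 'rV[R]_m := \row_j \sum_i z ord0 (ix i j).
pose P z : V := (x z, y z).
have xS z : simplex R (n * m) z -> simplex R n (x z).
  move=> [z0 z1]; split=> [i|]; first by rewrite mxE sumr_ge0.
  by under eq_bigr do rewrite mxE; rewrite -(sum_ix (z ord0)).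
have yS z : simplex R (n * m) z -> simplex R m (y z).
  move=> [z0 z1]; split=> [j|]; first by rewrite mxE sumr_ge0.
  by under eq_bigr do rewrite mxE; rewrite -(sum_ix' (z ord0)).
have cP : continuous P.
  have cz k : continuous (fun z : 'rV[R]_(n * m) => z ord0 k).
    exact: coord_continuous.
  have cx : continuous x.
    apply: (continuous_row _ _ _ (fun i (z : 'rV_(n * m)) => \sum_j z ord0 (ix i j))).
    by move=> i; exact: continuous_sum.
  have cy : continuous y.
    apply: (continuous_row _ _ _ (fun j (z : 'rV_(n * m)) => \sum_i z ord0 (ix i j))).
    by move=> j; exact: continuous_sum.
  by move=> z; exact: cvg_pair (cx z) (cy z).
pose s (p : V) := \sum_i \sum_j f i j p.
pose t i (p : V) := Num.max 0 (p.1 ord0 i + s p * b i - \sum_j f i j p).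
pose u j (p : V) := Num.max 0 (p.2 ord0 j + s p * d j - \sum_i f i j p).
have cs : continuous s.
  apply: (continuous_sum _ _ _ (fun i p => \sum_j f i j p)) => i.
  exact: continuous_sum.
have c1 (i : 'I_n) := @continuous_fst_coord R n m i.
have c2 (j : 'I_m) := @continuous_snd_coord R n m j.
have ct i : continuous (t i).
  exact: continuous_excess (c1 i) cs (continuous_sum _ _ _ (f i) (cf i)).
have cu j : continuous (u j).
  exact: continuous_excess (c2 j) cs (continuous_sum _ _ _ (f^~ j) (cf^~ j)).
have t0 i p : 0 <= t i p by rewrite le_max lexx.
have u0 j p : 0 <= u j p by rewrite le_max lexx.
(* The total mass of the matrix [t i p * u j p]. The fixed-point conditions are kept multiplied by
   [W], which avoids quotients. *)
pose W p := (\sum_i t i p) * \sum_j u j p.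
have WE p : W p = \sum_i \sum_j t i p * u j p.
  by rewrite /W mulr_suml; apply: eq_bigr => i _; rewrite mulr_sumr.
have cW : continuous W.
  exact: continuous_mul (continuous_sum _ _ _ t ct) (continuous_sum _ _ _ u cu).
pose g k : 'I_n * 'I_m := enum_val (cast_ord (esym (mxvec_cast n m)) k).
have gK i j : g (ix i j) = (i, j) by rewrite /g /ix /mxvec_index cast_ordK enum_rankK.
have [|||z zS zC] := @dual_kkm R (n * m)
    (fun k => [set z : 'rV[R]_(n * m) |
       z ord0 k * W (P z) <= t (g k).1 (P z) * u (g k).2 (P z)]).
- by rewrite muln_gt0 n0.
- move=> k; have cPo (h : V -> R) : continuous h -> continuous (h \o P).
    by move=> ch z; apply: continuous_comp; [exact: cP|exact: ch].
  have cz : continuous (fun z : 'rV[R]_(n * m) => z ord0 k).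
    exact: coord_continuous.
  exact: closed_le_fun (continuous_mul _ _ _ _ cz (cPo W cW))
    (continuous_mul _ _ _ _ (cPo _ (ct _)) (cPo _ (cu _))).
(* If every entry strictly decreased, summing over all entries would give [W (P z) < W (P z)]. *)
- move=> z [z0 z1]; apply: contrapT => /forallNP nC.
  suff : W (P z) < W (P z) by rewrite ltxx.
  rewrite {1}WE -[ltRHS]mul1r -z1 mulr_suml sum_ix.
  rewrite !pair_big /=; apply: ltr_sum.
    by apply/hasP; exists (Ordinal n0, Ordinal m0); rewrite // mem_index_enum.
  move=> [i j] _ /=; have := nC (ix i j); rewrite /= gK /= => /negP.
  by rewrite -ltNge.
(* The inequality now holds at every entry, trivially where [z] vanishes. Both sides have the same
   sum, so all are equalities. *)
have {}zC i j : z ord0 (ix i j) * W (P z) = t i (P z) * u j (P z).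
  have le k : 0 <= t (g k).1 (P z) * u (g k).2 (P z) - z ord0 k * W (P z).
    by rewrite subr_ge0; have [->|//] := zC k; rewrite mul0r mulr_ge0.
  have sum0 : \sum_k (t (g k).1 (P z) * u (g k).2 (P z) - z ord0 k * W (P z)) = 0.
    rewrite sumrB -mulr_suml; have [_ ->] := zS; rewrite mul1r sum_ix WE.
    apply/eqP; rewrite subr_eq0; apply/eqP.
    by apply: eq_bigr => i' _; apply: eq_bigr => j' _; rewrite gK.
  have := psumr_eq0P (fun k _ => le k) sum0 (i := ix i j) isT.
  by rewrite gK /= => /eqP; rewrite subr_eq0 => /eqP.
have [xz yz] : simplex R n (x z) /\ simplex R m (y z) by split; auto.
have s0 : 0 < s (P z).
  have [i [j fij]] := fpos (P z) xz yz.
  rewrite /s (bigD1 i) //= (bigD1 j) //= -addrA ltr_wpDr // addr_ge0 ?sumr_ge0 //.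
  by move=> i' _; rewrite sumr_ge0.
have [T1 balT] := @fixed_balance R n (x z ord0) b (fun i => \sum_j f i j (P z)) (s (P z))
  s0 xz.1 xz.2 (fun i xi => big1 _ _ _ (fun j _ => fx i j (P z) xz yz xi)) erefl b0 b1.
have [U1 balU] := @fixed_balance R m (y z ord0) d (fun j => \sum_i f i j (P z)) (s (P z))
  s0 yz.1 yz.2 (fun j yj => big1 _ _ _ (fun i _ => fy i j (P z) xz yz yj))
  (exchange_big _ _ _ _ _ _) d0 d1.
have T0 : \sum_i t i (P z) != 0 by rewrite gt_eqF // (lt_le_trans ltr01).
have U0 : \sum_j u j (P z) != 0 by rewrite gt_eqF // (lt_le_trans ltr01).
exists (P z), (s (P z)); split=> //.
(* Summing the equalities along row [i] gives the fixed-point equation for [x z], up to the nonzero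
   factor [\sum_j u j (P z)]. *)
- apply: balT => i; apply: (mulIf U0); rewrite -mulrA -/(W (P z)) mxE mulr_suml.
  by rewrite mulr_sumr; apply: eq_bigr => j _; rewrite zC /t /= mxE.
- apply: balU => j; apply: (mulIf T0).
  rewrite -mulrA [X in _ * X]mulrC -/(W (P z)) mxE mulr_suml.
  by rewrite mulr_sumr; apply: eq_bigr => i _; rewrite zC mulrC /u /= mxE.
Qed.

(** * The covering theorem *)

(** The function is the distance to the complement of [U], capped at 1. The cap keeps the infimum
    over a nonempty set even when [U] is the whole space. *)
Lemma open_positivity_set (R : realType) (V : normedModType R) (U : set V) :
  open U -> exists f : V -> R,
    [/\ continuous f, (forall p, 0 <= f p) & forall p, 0 < f p <-> U p].
Proof.
move=> oU; pose E p : set R := 1 |` [set `|p - q| | q in ~` U].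
have E0 p : lbound (E p) 0 by move=> _ [->//|[q _ <-]].
have hE p : has_lbound (E p) by exists 0.
have nE p : E p !=set0 by exists 1; left.
exists (fun p => inf (E p)).
have lip p p' : inf (E p) <= inf (E p') + `|p - p'|.
  rewrite -lerBlDr; apply: lb_le_inf => // _ [->|[q Uq <-]].
    by rewrite lerBlDr (le_trans (ge_inf (hE p) (or_introl erefl : E p 1))) ?lerDl.
  rewrite lerBlDr addrC; apply: le_trans (ler_distD p' p q).
  by apply: ge_inf => //; right; exists q.
split=> [p|p|p].
- apply/cvgrPdist_lt => e e0; near=> p'.
  have pp' : `|p - p'| < e.
    by near: p'; apply/nbhs_ballP; exists e => //= q; rewrite -ball_normE.
  have := lip p p'; have := lip p' p; rewrite (distrC p' p) ltr_norml => h1 h2.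
  by apply/andP; split; lra.
- exact: lb_le_inf.
split=> [f0|Up].
  apply: contrapT => nU; have : inf (E p) <= 0.
    by apply: ge_inf => //; right; exists p; rewrite ?subrr ?normr0.
  by rewrite leNgt f0.
have /nbhs_ballP[e /= e0 eU] : nbhs p U by apply: open_nbhs_nbhs.
apply: (@lt_le_trans _ _ (Num.min 1 e)); first by rewrite lt_min ltr01.
apply: lb_le_inf => // _ [->|[q nUq <-]]; first by rewrite ge_min lexx.
rewrite ge_min; apply/orP; right; rewrite leNgt; apply/negP => pq.
by apply: nUq; apply: eU; rewrite -ball_normE.
Unshelve. all: by end_near. Qed.

Lemma open_gt0_fun (R : realType) (T : topologicalType) (f : T -> R) :
  continuous f -> open [set x | 0 < f x].
Proof.
move=> cf; rewrite (_ : [set x | _] = f @^-1` [set y | 0 < y]) //.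
by apply: open_comp => [x _|]; [exact: cf|exact: open_gt].
Qed.

Lemma colorful_open (R : realType) (n m : nat)
    (U : 'I_n -> 'I_m -> set ('rV[R]_n * 'rV[R]_m)) (a : 'I_n -> nat) :
  (0 < n)%N -> (0 < m)%N ->
  (forall i j, open (U i j)) ->
  simplex R n `*` simplex R m `<=` \bigcup_i \bigcup_j U i j ->
  (forall i j, U i j `&` (simplex_facet R i `*` simplex R m) = set0) ->
  (forall i j, U i j `&` (simplex R n `*` simplex_facet R j) = set0) ->
  (forall i, (0 < a i)%N) -> (\sum_i a i)%N = m ->
  exists sigma : 'I_m -> 'I_n,
    (forall i, #|sigma @^-1: pred1 i| = a i) /\
    exists2 p, (simplex R n `*` simplex R m) p & forall j, U (sigma j) j p.
Proof.
move=> n0 m0 oU cov Ul Ur a0 suma.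
have /choice[f fP] := fun ij : 'I_n * 'I_m => open_positivity_set _ _ _ (oU ij.1 ij.2).
have f0 i j p : 0 <= f (i, j) p by have [_ + _] := fP (i, j); apply.
have fU i j p : 0 < f (i, j) p <-> U i j p by have [_ _] := fP (i, j); apply.
have fN i j p : ~ U i j p -> f (i, j) p = 0.
  by move=> nU; apply/eqP; rewrite eq_le f0 andbT leNgt; apply/negP => /fU.
have mR : m%:R != 0 :> R by rewrite pnatr_eq0 -lt0n.
(* With these weights the row sums are [a i] times the common column sum [s / m%:R], as
   [transport_support] requires. *)
have [|||||||||p [s [[sx sy] s0 fr fc]]] := @transport_point R n m (fun i j => f (i, j))
    (fun i => (a i)%:R / m%:R) (fun=> m%:R^-1) n0 m0.
- by move=> i j; have [] := fP (i, j).
- by [].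
- move=> i j p px py xi; apply: fN => Up.
  by have : (set0 : set ('rV[R]_n * 'rV[R]_m)) p by rewrite -(Ul i j).
- move=> i j p px py yj; apply: fN => Up.
  by have : (set0 : set ('rV[R]_n * 'rV[R]_m)) p by rewrite -(Ur i j).
- move=> p px py; have [i _ [j _ Up]] := cov p (conj px py).
  by exists i, j; apply/fU.
- by move=> i; rewrite divr_gt0 ?ltr0n.
- by rewrite -mulr_suml -natr_sum suma divff.
- by move=> j; rewrite invr_gt0 ltr0n.
- by rewrite sumr_const card_ord -(mulr_natr m%:R^-1) mulVf.
have [|||||sg [sga sgf]] :=
  @transport_support R n m (fun i j => f (i, j) p) (s / m%:R) a n0.
- by rewrite divr_gt0 ?ltr0n.
- by [].
- by move=> i; rewrite fr; ring.
- by move=> j; rewrite fc.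
- by [].
exists sg; split=> //; exists p => [|j]; first by split.
by apply/fU.
Qed.

Theorem theorem1 (R : realType) (n m : nat) (n_gt0 : (0 < n)%N)
    (le_nm : (n <= m)%N)
    (A : 'I_n -> 'I_m -> set ('rV[R]_n * 'rV[R]_m))
    (A_sub : forall i j, A i j `<=` simplex R n `*` simplex R m)
    (A_cover : simplex R n `*` simplex R m `<=` \bigcup_i \bigcup_j A i j)
    (A_open_closed :
      (forall i j, open (A i j : set (subspace (simplex R n `*` simplex R m))))
      \/
      (forall i j,
        closed (A i j : set (subspace (simplex R n `*` simplex R m)))))
    (A_facetl : forall i j,
      A i j `&` (simplex_facet R i `*` simplex R m) = set0)
    (A_facetr : forall i j,
      A i j `&` (simplex R n `*` simplex_facet R j) = set0)
    (a : 'I_n -> nat) (a_gt0 : forall i, (0 < a i)%N)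
    (sum_a : (\sum_(i < n) a i)%N = m) :
  exists sigma : 'I_m -> 'I_n,
    (forall i, #|sigma @^-1: pred1 i| = a i) /\
    \bigcap_j A (sigma j) j !=set0.
Proof.
have m_gt0 : (0 < m)%N := leq_trans n_gt0 le_nm.
set K := simplex R n `*` simplex R m in A_sub A_cover A_open_closed *.
have AK i j : A i j `&` K = A i j by apply/setIidl/A_sub.
have facetl i j p : A i j p -> p.1 ord0 i != 0.
  move=> Ap; apply/eqP => xi; have [sx sy] := A_sub i j p Ap.
  by have : (set0 : set ('rV[R]_n * 'rV[R]_m)) p by rewrite -(A_facetl i j).
have facetr i j p : A i j p -> p.2 ord0 j != 0.
  move=> Ap; apply/eqP => yj; have [sx sy] := A_sub i j p Ap.
  by have : (set0 : set ('rV[R]_n * 'rV[R]_m)) p by rewrite -(A_facetr i j).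
case: A_open_closed => [oA|cA].
  have /choice[U UP] : forall ij : 'I_n * 'I_m, exists V, open V /\ V `&` K = A ij.1 ij.2.
    by move=> [i j]; have /open_subspaceP[V oV VE] := oA i j; exists V; rewrite VE AK.
  have UA i j p : K p -> U (i, j) p -> A i j p.
    by move=> Kp Up; have [_ /= <-] := UP (i, j).
  have [||||sg [sga [p Kp Up]]] :=
    @colorful_open R n m (fun i j => U (i, j)) a n_gt0 m_gt0 _ _ _ _ a_gt0 sum_a.
  - by move=> i j; have [] := UP (i, j).
  - move=> p /A_cover[i _ [j _ Ap]]; exists i => //; exists j => //.
    by move: Ap; have [_ /= <-] := UP (i, j) => -[].
  - move=> i j; apply/seteqP; split=> // p [Up [[sx xi] sy]].
    by have /eqP := facetl i j p (UA i j p (conj sx sy) Up).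
  - move=> i j; apply/seteqP; split=> // p [Up [sx [sy yj]]].
    by have /eqP := facetr i j p (UA i j p (conj sx sy) Up).
  by exists sg; split=> //; exists p => j _; apply: UA.
(* Assignments are taken as finite functions, so that there are finitely many of them for the
   pigeonhole argument below. *)
pose near_all (sg : {ffun 'I_m -> 'I_n}) k := exists2 p, K p &
  forall j, exists2 q, A (sg j) j q & ball q k.+1%:R^-1 p.
have ex k : exists2 sg : {ffun 'I_m -> 'I_n},
    (forall i, #|sg @^-1: pred1 i| = a i) & near_all sg k.
  pose e : R := k.+1%:R^-1.
  have e0 : 0 < e by rewrite invr_gt0.
  (* The positivity conditions remove the facets that the enlarged sets may reach; no point of
     [A i j] is lost. *)
  pose U i j := (\bigcup_(q in A i j) (ball q e)^°) `&`
    [set p : 'rV[R]_n * 'rV[R]_m | 0 < p.1 ord0 i] `&`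
    [set p : 'rV[R]_n * 'rV[R]_m | 0 < p.2 ord0 j].
  have [||||sg [sga [p Kp Up]]] :=
    @colorful_open R n m U a n_gt0 m_gt0 _ _ _ _ a_gt0 sum_a.
  - move=> i j; apply: openI; first apply: openI.
    + by apply: bigcup_open => q _; exact: open_interior.
    + exact: open_gt0_fun (@continuous_fst_coord R n m i).
    + exact: open_gt0_fun (@continuous_snd_coord R n m j).
  - move=> p /[dup] -[[x0 _] [y0 _]] /A_cover[i _ [j _ Ap]].
    exists i => //; exists j => //; split; first split.
    + exists p => //; exact: nbhsx_ballx.
    + by rewrite /= lt_def x0 (facetl i j).
    + by rewrite /= lt_def y0 (facetr i j).
  - by move=> i j; apply/seteqP; split=> // p [[[_ /= +] _] [[_ xi] _]]; rewrite xi ltxx.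
  - by move=> i j; apply/seteqP; split=> // p [[_ /= +] [_ [_ yj]]]; rewrite yj ltxx.
  exists [ffun j => sg j].
    by move=> i; rewrite -sga; apply: eq_card => j; rewrite !inE ffunE.
  exists p => // j; have [[[q Aq qp] _] _] := Up j.
  by exists q; rewrite ?ffunE //; apply: interior_subset qp.
have [sg [sga sgn]] : exists sg : {ffun 'I_m -> 'I_n},
    (forall i, #|sg @^-1: pred1 i| = a i) /\ forall k, near_all sg k.
  (* If each admissible assignment failed at some [k], it would fail from there on, since the
     tolerance shrinks. Being finitely many, all would fail for some common [k], against [ex]. *)
  apply: contrapT => /forallNP no.
  have : \forall k \near \oo, forall sg : {ffun 'I_m -> 'I_n},
      ~ ((forall i, #|sg @^-1: pred1 i| = a i) /\ near_all sg k).
    apply: filter_forall => sg.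
    have [sga|nsga] := pselect (forall i, #|sg @^-1: pred1 i| = a i); last first.
      by near=> k => -[].
    have [k0 nk0] : exists k, ~ near_all sg k.
      apply: contrapT => /forallNP/= h; apply: (no sg); split=> // k.
      by apply: contrapT; exact: h.
    exists k0 => // k /= k0k [_ [p Kp pA]]; apply: nk0; exists p => // j.
    have [q Aq qp] := pA j; exists q => //; apply: le_ball qp.
    by rewrite lef_pV2 ?posrE ?ltr0n // ler_nat ltnS.
  by move=> [k _ /(_ k (leqnn k))] h; have [sg sga sgk] := ex k; apply: (h sg).
have /choice[p pP] : forall k, exists p, K p /\
    forall j, exists2 q, A (sg j) j q & ball q k.+1%:R^-1 p.
  by move=> k; have [p] := sgn k; exists p.
have [||z Kz zp] := @compact_cluster_seq R _ K p.
- by apply: compact_setX; exact: compact_simplex.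
- by move=> k; have [] := pP k.
exists sg; split=> //; exists z => j _.
have /closed_subspaceP[V cV VE] := cA (sg j) j.
rewrite -[A _ _]AK -VE; split=> //; apply: cV => B /nbhs_ballP[e /= e0 zeB].
have e20 : 0 < e / 2 by rewrite divr_gt0.
(* Half of [e] covers the distance from [z] to [p k]; the choice of [k] makes [1 / k.+1] at most the
   other half, the distance from [p k] to the set. *)
have [k k0k zk] := zp (e / 2) (Num.bound (e / 2)^-1) e20.
have [_ /(_ j)[q Aq qp]] := pP k.
exists q; split.
  suff [] : (V `&` K) q by [].
  by rewrite VE AK.
apply: zeB; rewrite [e]splitr; apply: ball_triangle zk _; apply: ball_sym.
apply: le_ball qp; rewrite -[leRHS]invrK lef_pV2 ?posrE ?invr_gt0 ?ltr0n //.
apply: le_trans (ltW (archi_boundP _)) _; first by rewrite invr_ge0 ltW.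
by rewrite ler_nat (leq_trans k0k).
Unshelve. all: by end_near. Qed.
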